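(* Let $\mathcal{L}:\mathbb{R}^d\to\mathbb{R}$ be differentiable, let $\boldsymbol{g}(\boldsymbol{\theta})$ be a stochastic gradient with $\mathbb{E}[\boldsymbol{g}(\boldsymbol{\theta})]=\nabla\mathcal{L}(\boldsymbol{\theta})$ for every $\boldsymbol{\theta}\in\mathbb{R}^d$, and let $\epsilon>0$, $\eta>0$. Assume: 1. there is $\mathcal{L}^\star\in\mathbb{R}$ with $\mathcal{L}(\boldsymbol{\theta})\ge\mathcal{L}^\star$ for all $\boldsymbol{\theta}$; 2. there is $H>0$ with $\|\nabla\mathcal{L}(\boldsymbol{\theta})-\nabla\mathcal{L}(\boldsymbol{\theta}')\|_2\le H\|\boldsymbol{\theta}-\boldsymbol{\theta}'\|_2$ for all $\boldsymbol{\theta},\boldsymbol{\theta}'$; 3. there is $R>0$ with $\|\boldsymbol{g}(\boldsymbol{\theta})\|_\infty+\epsilon\le R$ almost surely for all $\boldsymbol{\theta}$, and moreover $R<1$; 4. (low noise) there are constants $p\in(0,1)$ and $c>0$ such that $\mathbb{E}[\varphi_p(g_i(\boldsymbol{\theta}))]\,\nabla_i\mathcal{L}(\boldsymbol{\theta})\ge c\,|\nabla_i\mathcal{L}(\boldsymbol{\theta})|^{p+1}$ for all $\boldsymbol{\theta}\in\mathbb{R}^d$ and all $i\in\{1,\dots,d\}$. Let $(\boldsymbol{\theta}_t)_{t\ge1}$ be generated by AdagradPower with this power $p$, learning rate $\eta$ and parameter $\epsilon$, from a deterministic initial point $\boldsymbol{\theta}_1$. Then $$\min_{1\le t\le T}\mathbb{E}\left[\|\nabla\mathcal{L}(\boldsymbol{\theta}_t)\|_{p+1}^{p+1}\right]\le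 \mathcal{O}\left(\frac{\log T}{\sqrt{T}}\right),$$ i.e. there is a constant $C$, independent of $T$ (but possibly depending on $d,R,H,\epsilon,\eta,p,c,\mathcal{L}(\boldsymbol{\theta}_1)-\mathcal{L}^\star$), such that the left-hand side is at most $C\log T/\sqrt{T}$ for all integers $T\ge2$.
   Context: For $z\in\mathbb{R}$ and $p>0$, $\varphi_p(z)=|z|^p\,\mathrm{sign}(z)$; for a vector, $\varphi_p$ is applied coordinatewise. $g_i(\boldsymbol{\theta})$ and $\nabla_i\mathcal{L}(\boldsymbol{\theta})$ denote $i$-th coordinates. $\|\cdot\|_q$ is the $\ell_q$ norm. AdagradPower with power $p$: for $t\ge1$, $\boldsymbol{g}_t=\boldsymbol{g}(\boldsymbol{\theta}_t)$ is a fresh stochastic gradient at $\boldsymbol{\theta}_t$ (conditionally on the past, it is distributed as $\boldsymbol{g}(\boldsymbol{\theta})$ at $\boldsymbol{\theta}=\boldsymbol{\theta}_t$), and $$\boldsymbol{\theta}_{t+1}=\boldsymbol{\theta}_t-\eta\,\frac{\varphi_p(\boldsymbol{g}_t)}{\sqrt{\boldsymbol{v}_t+\epsilon}},\qquad \boldsymbol{v}_t=\sum_{s=1}^t\varphi_p(\boldsymbol{g}_s)^2,$$ where squares, square roots, addition of $\epsilon$ and division are coordinatewise. *)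

(* Defs.v *)
From HB Require Import structures.
From mathcomp Require Import all_boot all_order all_algebra.
From mathcomp Require Import all_classical all_reals all_analysis.
From mathcomp Require Import measurable_realfun.
Import Order.TTheory GRing.Theory Num.Theory.
Import numFieldNormedType.Exports.

Set Implicit Arguments.
Unset Strict Implicit.
Unset Printing Implicit Defensive.

Local Open Scope classical_set_scope.
Local Open Scope ring_scope.

(* R^d is 'rV[R]_d with its Borel sigma-algebra. On 'rV[R]_d, the library norm
   `|x| is the max norm, i.e. the l_infinity norm. *)
Definition openRV (R : realType) (d : nat) : set (set 'rV[R]_d) :=
  [set A | open A].

HB.instance Definition _ (R : realType) (d : nat) :=
  @isMeasurable.Build (sigma_display (@openRV R d)) 'rV[R]_d
    <<s @openRV R d >> (@sigma_algebra0 _ _ _)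
    (@sigma_algebraC _ (@openRV R d))
    (@sigma_algebra_bigcup _ _ _).

Definition lqnorm (R : realType) (d : nat) (q : R) (x : 'rV[R]_d) : R :=
  (\sum_(i < d) `|x 0 i| `^ q) `^ q^-1.

Definition grad (R : realType) (d : nat) (L : 'rV[R]_d -> R)
    (theta : 'rV[R]_d) : 'rV[R]_d :=
  \row_(i < d) 'D_(delta_mx 0 i) L theta.

Definition phi (R : realType) (p z : R) : R := `|z| `^ p * Num.sg z.

Definition phi_vec (R : realType) (d : nat) (p : R) (x : 'rV[R]_d) : 'rV[R]_d :=
  map_mx (phi p) x.

Definition adagrad_v (R : realType) (d : nat) (p : R) (G : nat -> 'rV[R]_d)
    (t : nat) : 'rV[R]_d :=
  \sum_(1 <= s < t.+1) map_mx (fun y => y ^+ 2) (phi_vec p (G s)).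

(* One trajectory: G lists the stochastic gradients and Theta the iterates.
   Times start at 1; G 0 and Theta 0 are never used. *)
Definition adagrad_power (R : realType) (d : nat) (eta eps p : R)
    (G Theta : nat -> 'rV[R]_d) : Prop :=
  forall t : nat, (1 <= t)%N ->
    Theta t.+1 = Theta t - eta *:
      \row_(i < d) (phi_vec p (G t) 0 i
                    / Num.sqrt (adagrad_v p G t 0 i + eps)).

(* The sigma-algebra generated by G 1, ..., G (t - 1). When Theta 1 is
   deterministic, Theta 1, ..., Theta t of adagrad_power are functions of these
   vectors, so this is the whole past of the algorithm before G t is drawn. *)
Definition past (R : realType) (d : nat) (Omega : Type)
    (G : nat -> Omega -> 'rV[R]_d) (t : nat) : set (set Omega) :=
  <<s [set A | exists s : nat, (1 <= s < t)%N /\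
         exists2 B : set 'rV[R]_d, measurable B & A = G s @^-1` B] >>.

(* mu is a regular conditional distribution of Y given the sub-sigma-algebra F:
   for all Borel B, mu _ B is a version of P(Y \in B | F). *)
Definition conditional_law (R : realType) (d : nat) (dO : measure_display)
    (Omega : measurableType dO) (P : probability Omega R)
    (F : set (set Omega)) (Y : Omega -> 'rV[R]_d)
    (mu : Omega -> set 'rV[R]_d -> \bar R) : Prop :=
  forall B : set 'rV[R]_d, measurable B ->
    (forall D : set (\bar R), measurable D -> F ((mu ^~ B) @^-1` D)) /\
    (forall A : set Omega, F A ->
       P (A `&` Y @^-1` B) = (\int[P]_(w in A) mu w B)%E).

(* Main.v *)
Require Import Defs.
From HB Require Import structures.
From mathcomp Require Import all_boot all_order all_algebra.
From mathcomp Require Import all_classical all_reals all_analysis.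
From mathcomp Require Import measurable_realfun.
From mathcomp Require Import ring lra.
Import Order.TTheory GRing.Theory Num.Theory.
Import numFieldNormedType.Exports.

Set Implicit Arguments.
Unset Strict Implicit.
Unset Printing Implicit Defensive.

Local Open Scope classical_set_scope.
Local Open Scope ring_scope.

(* Adaptive steps are compared with the scales a_(t-1) = (v_(t-1) + eps)^(-1/2)
   known before g_t is drawn. Since |grad_i L| <= 1 and |phi_p(g_t,i)| <= 1, the
   cost of replacing a_t by a_(t-1) is at most a_(t-1) - a_t, which telescopes to
   eps^(-1/2); the second-order term of the descent lemma is at most
   ln(v_t + eps) - ln(v_(t-1) + eps), which telescopes to ln(1 + T / eps).
   Conditionally on the past, the low-noise assumption turns
   grad_i L * a_(t-1) * phi_p(g_t,i) into at least c |grad_i L|^(p+1) a_(t-1),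
   and a_(t-1) >= (T + eps)^(-1/2). Hence sum_(t <= T) E |grad L|_(p+1)^(p+1) is
   O(sqrt T * ln T). *)

(** * Image laws and disintegration along a probability kernel *)

Section image_law.
Context (R : realType) (d1 d2 : measure_display) (T1 : measurableType d1)
  (T2 : measurableType d2).

Definition mfun_of (f : T1 -> T2) (mf : measurable_fun setT f) : {mfun T1 >-> T2} :=
  HB.pack f (isMeasurableFun.Build _ _ _ _ f mf).

Definition image_law (mu : probability T1 R) (f : T1 -> T2)
    (mf : measurable_fun setT f) : probability T2 R :=
  distribution mu (mfun_of mf).

End image_law.

Section disintegration.
Context (R : realType) (dO dS dY : measure_display) (Omega : measurableType dO)
  (S : measurableType dS) (Y : measurableType dY) (P : probability Omega R).
Variables (f : Omega -> S) (y : Omega -> Y) (k : S -> probability Y R).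
Hypotheses (mf : measurable_fun setT f) (my : measurable_fun setT y).
Hypothesis mk : forall B, measurable B -> measurable_fun setT (fun s => k s B).
Hypothesis joint : forall A B, measurable A -> measurable B ->
  (P (f @^-1` A `&` y @^-1` B) = \int[P]_(w in f @^-1` A) k (f w) B)%E.
Local Open Scope ereal_scope.

Let ker (s : S) : {measure set Y -> \bar R} := k s.

HB.instance Definition _ := isKernel.Build _ _ _ _ _ ker mk.

Let ker_prob s : ker s setT = 1. Proof. exact: probability_setT. Qed.

HB.instance Definition _ := Kernel_isProbability.Build _ _ _ _ _ ker ker_prob.

(** The law of the pair [(s, z)] with [z] drawn from [k s]. The factor [unit] fits the type of [\;],
    whose second kernel also receives the source point of the first. *)
Let kpair (x : unit * S) : {measure set (S * Y) -> \bar R} :=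
  image_law (k x.2) (pair1_measurable x.2).

Let kpairE x U : kpair x U = k x.2 (xsection U x.2).
Proof.
rewrite /kpair /image_law /= /distribution /pushforward /=; congr (k x.2 _).
by apply/seteqP; split => z; rewrite /xsection/= inE.
Qed.

Let mkpair U : measurable U -> measurable_fun [set: unit * S] (kpair ^~ U).
Proof.
move=> mU; rewrite (_ : kpair ^~ U = (fun s => ker s (xsection U s)) \o snd).
  apply: measurableT_comp => //.
  by apply: measurable_fun_xsection_finite_kernel; rewrite inE.
by apply/funext => x; rewrite kpairE.
Qed.

HB.instance Definition _ := isKernel.Build _ _ _ _ _ kpair mkpair.

Let kpair_prob x : kpair x setT = 1.
Proof. exact: probability_setT. Qed.

HB.instance Definition _ := Kernel_isProbability.Build _ _ _ _ _ kpair kpair_prob.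

Let klaw : unit -> {measure set S -> \bar R} := fun=> image_law P mf.

Let mklaw U : measurable U -> measurable_fun [set: unit] (klaw ^~ U).
Proof. by move=> mU; exact: measurable_cst. Qed.

HB.instance Definition _ := isKernel.Build _ _ _ _ _ klaw mklaw.

Let klaw_prob x : klaw x setT = 1.
Proof. exact: probability_setT. Qed.

HB.instance Definition _ := Kernel_isProbability.Build _ _ _ _ _ klaw klaw_prob.

Let mfy : measurable_fun setT (fun w => (f w, y w)).
Proof. exact: measurable_fun_pair. Qed.

(** Two finite measures that agree on measurable rectangles, by [joint]; rectangles are stable under
    intersection and generate the product sigma-algebra. *)
Let joint_law U : measurable U -> image_law P mfy U = (klaw \; kpair) tt U.
Proof.
move=> mU.
pose C : set (set (S * Y)) := [set A `*` B | A in measurable & B in measurable].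
have CI : setI_closed C.
  move=> _ _ [X1 mX1 [X2 mX2 <-]] [Y1 mY1 [Y2 mY2 <-]].
  exists (X1 `&` Y1); first exact: measurableI.
  by exists (X2 `&` Y2); [exact: measurableI|rewrite setXI].
have CT : C setT by exists setT => //; exists setT => //; rewrite setXTT.
apply: (measure_unique C (fun=> setT)) => //.
- exact: measurable_prod_measurableType.
- by rewrite bigcup_const.
- move=> _ [A mA [B mB <-]].
  rewrite /image_law /= /distribution /pushforward /=.
  rewrite (_ : _ @^-1` _ = f @^-1` A `&` y @^-1` B)// joint// /mkcomp /= /kcomp.
  rewrite ge0_integral_distribution//; last first.
    exact: (measurableT_comp (mkpair (measurableX mA mB)) (pair1_measurable tt)).
  rewrite [RHS](_ : _ = \int[P]_w (k (f w) B * (\1_(f @^-1` A) w)%:E)).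
    rewrite integral_mkcond; apply: eq_integral => w _.
    by rewrite patchE indicE; case: ifP; rewrite ?mule1 ?mule0.
  apply: eq_integral => w _; transitivity (k (f w) (xsection (A `*` B) (f w))).
    exact: (kpairE (tt, f w)).
  rewrite indicE (_ : (w \in _) = (f w \in A)); last by apply/idP/idP; rewrite !inE.
  have [xA|xA] := boolP (f w \in A); first by rewrite in_xsectionX// mule1.
  by rewrite notin_xsectionX// measure0 mule0.
- move=> n; rewrite (_ : _ setT = 1) ?ltry//; exact: (probability_setT (image_law P mfy)).
Qed.

(** A change of variables leads to the joint law, which [joint_law] writes as a kernel composition;
    integrating against a composition gives the iterated integral. *)
Lemma ge0_integral_disintegration (F : S * Y -> \bar R) :
  measurable_fun setT F -> (forall x, 0 <= F x) ->
  \int[P]_w F (f w, y w) = \int[P]_w \int[k (f w)]_z F (f w, z).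
Proof.
move=> mF F0.
transitivity (\int[mkcomp klaw kpair tt]_x F x).
  transitivity (\int[image_law P mfy]_x F x).
    by rewrite ge0_integral_distribution.
  by apply: eq_measure_integral => A mA _; exact: joint_law.
rewrite integral_kcomp//= ge0_integral_distribution//.
- apply: eq_integral => w _ /=; rewrite ge0_integral_distribution//.
- apply: measurable_fun_integral_kernel => // U mU.
  exact: (measurableT_comp (mkpair mU) (pair1_measurable tt)).
- by move=> s; apply: integral_ge0.
Qed.

End disintegration.

(** * Bounded measurable functions on a probability space *)

Section bounded_mfun.
Context (R : realType) (dT : measure_display) (T : measurableType dT)
  (P : probability T R).

(** The bound holds everywhere, not almost everywhere: such functions are integrable under every
    probability and stable under sums, products and composition. *)
Definition bounded_mfun (f : T -> R) : Prop :=
  measurable_fun setT f /\ exists M, forall x, `|f x| <= M.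

Lemma bounded_mfun_integrable f : bounded_mfun f -> P.-integrable setT (EFin \o f).
Proof.
move=> [mf [M fM]]; apply: measurable_bounded_integrable => //.
  by apply: fin_num_fun_lty; exact: fin_num_measure.
exists M; split; first exact: num_real.
by move=> x Mx z _ /=; exact: le_trans (fM z) (ltW Mx).
Qed.

Lemma bounded_mfun_cst r : bounded_mfun (fun=> r).
Proof. by split; [exact: measurable_cst|exists `|r|]. Qed.

Lemma bounded_mfunD f g : bounded_mfun f -> bounded_mfun g ->
  bounded_mfun (fun x => f x + g x).
Proof.
move=> [mf [M fM]] [mg [N gN]]; split; first exact: measurable_funD.
by exists (M + N) => x; rewrite (le_trans (ler_normD _ _))// lerD.
Qed.

Lemma bounded_mfunM f g : bounded_mfun f -> bounded_mfun g ->
  bounded_mfun (fun x => f x * g x).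
Proof.
move=> [mf [M fM]] [mg [N gN]]; split; first exact: measurable_funM.
by exists (M * N) => x; rewrite normrM ler_pM.
Qed.

Lemma bounded_mfun_sum (I : Type) (s : seq I) (Q : pred I) (f : I -> T -> R) :
  (forall i, Q i -> bounded_mfun (f i)) ->
  bounded_mfun (fun x => \sum_(i <- s | Q i) f i x).
Proof.
move=> bf; elim: s => [|i s ih].
  by under eq_fun do rewrite big_nil; exact: bounded_mfun_cst.
under eq_fun do rewrite big_cons.
by case: (boolP (Q i)) => Qi //; apply: bounded_mfunD => //; exact: bf.
Qed.

Lemma Rintegral_sum (I : Type) (s : seq I) (Q : pred I) (f : I -> T -> R) :
  (forall i, Q i -> bounded_mfun (f i)) ->
  (\int[P]_x (\sum_(i <- s | Q i) f i x) = \sum_(i <- s | Q i) \int[P]_x f i x)%R.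
Proof.
move=> bf; elim: s => [|i s ih].
  under eq_Rintegral do rewrite big_nil.
  by rewrite big_nil Rintegral_cst// mul0r.
rewrite big_cons -ih; under eq_Rintegral do rewrite big_cons.
case: (boolP (Q i)) => Qi //; rewrite RintegralD//; apply: bounded_mfun_integrable.
  exact: bf.
exact: bounded_mfun_sum.
Qed.

(** With the maximum of [f] and [g] in place of [g] the comparison holds everywhere, and the
    integral is unchanged because the two agree almost everywhere. *)
Lemma bounded_mfun_le_Rintegral f g : bounded_mfun f -> bounded_mfun g ->
  {ae P, forall x, f x <= g x} -> (\int[P]_x f x <= \int[P]_x g x)%R.
Proof.
move=> bf bg fg; have bm : bounded_mfun (fun x => Num.max (f x) (g x)).
  move: bf bg => [mf [M fM]] [mg [N gN]]; split.
    exact: measurable_maxr.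
  exists (M + N) => x; have := fM x; have := gN x.
  have := normr_ge0 (f x); have := normr_ge0 (g x); rewrite /Num.max.
  by case: ifP => _; lra.
rewrite (_ : (\int[P]_x g x)%R = (\int[P]_x (Num.max (f x) (g x)))%R).
  apply: le_Rintegral => //; try exact: bounded_mfun_integrable.
  by move=> x _; rewrite le_max lexx.
congr fine; apply: ae_eq_integral => //.
- by apply/measurable_EFinP; exact: bg.1.
- by apply/measurable_EFinP; exact: bm.1.
- by apply: filterS fg => x fgx _; congr EFin; rewrite max_r.
Qed.

Lemma Rintegral_probability_cst r : (\int[P]_x r)%R = r.
Proof.
rewrite Rintegral_cst//= [X in fine X](_ : _ = 1%E) ?mulr1//.
exact: probability_setT.
Qed.

End bounded_mfun.

Lemma bounded_mfun_comp (R : realType) (d1 d2 : measure_display) (T1 : measurableType d1)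
    (T2 : measurableType d2) (u : T2 -> R) (v : T1 -> T2) :
  bounded_mfun u -> measurable_fun setT v ->
  bounded_mfun (fun x => u (v x)).
Proof.
move=> [mu [M uM]] mv; split; first exact: measurableT_comp.
by exists M => x; exact: uM.
Qed.

(** * From conditional to unconditional inequalities *)

Section conditional_inequality.
Context (R : realType) (dO dS dY : measure_display) (Omega : measurableType dO)
  (S : measurableType dS) (Y : measurableType dY) (P : probability Omega R).
Variables (f : Omega -> S) (y : Omega -> Y) (k : S -> probability Y R).
Hypotheses (mf : measurable_fun setT f) (my : measurable_fun setT y).
Hypothesis mk : forall B, measurable B -> measurable_fun setT (fun s => k s B).
Hypothesis joint : forall A B, measurable A -> measurable B ->
  (P (f @^-1` A `&` y @^-1` B) = \int[P]_(w in f @^-1` A) k (f w) B)%E.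

(** The factor [X] is known from [f], so conditioning on [f] averages [h] alone, under [k]. *)
Lemma le_Rintegral_disintegration (X : S -> R) (h : Y -> R) (Z : Omega -> R) :
  bounded_mfun X -> bounded_mfun h -> bounded_mfun Z ->
  (forall w, Z w <= X (f w) * \int[k (f w)]_z h z) ->
  (\int[P]_w Z w <= \int[P]_w (X (f w) * h (y w)))%R.
Proof.
move=> bX bh bZ Zle.
have bF : bounded_mfun (fun x : S * Y => X x.1 * h x.2).
  by apply: bounded_mfunM; exact: bounded_mfun_comp.
have bW : bounded_mfun (fun w => X (f w) * h (y w)).
  by apply: bounded_mfunM; exact: bounded_mfun_comp.
have [mF [M FM]] := bF; have [_ [N ZN]] := bZ.
(* The disintegration formula is for nonnegative integrands. Both integrands are bounded by [K] in
   absolute value, so adding [K] reduces to that case. *)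
pose K := Num.max M N.
rewrite -(lerD2r K).
have -> : (\int[P]_w Z w + K = \int[P]_w (Z w + K))%R.
  rewrite RintegralD// ?Rintegral_probability_cst//; apply: bounded_mfun_integrable => //.
  exact: bounded_mfun_cst.
have -> : (\int[P]_w (X (f w) * h (y w)) + K = \int[P]_w (X (f w) * h (y w) + K))%R.
  rewrite RintegralD// ?Rintegral_probability_cst//; apply: bounded_mfun_integrable => //.
  exact: bounded_mfun_cst.
have bK (d' : measure_display) (T : measurableType d') (u : T -> R) : bounded_mfun u ->
    bounded_mfun (fun x => u x + K).
  by move=> bu; apply: bounded_mfunD => //; exact: bounded_mfun_cst.
rewrite /Rintegral; apply: fine_le.
- by apply: integrable_fin_num => //; exact/bounded_mfun_integrable/bK.
- by apply: integrable_fin_num => //; exact/bounded_mfun_integrable/bK.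
pose F := fun x : S * Y => (X x.1 * h x.2 + K)%:E.
have mF' : measurable_fun setT F.
  by apply/measurable_EFinP; exact: (bK _ _ _ bF).1.
have F0 x : (0 <= F x)%E.
  rewrite lee_fin; have := FM x; rewrite ler_norml => /andP[+ _].
  have : M <= K by rewrite /K le_max lexx.
  by lra.
have := ge0_integral_disintegration mf my mk joint mF' F0.
rewrite /F /= => ->.
have inner w : (\int[k (f w)]_z (X (f w) * h z + K)%:E =
    (X (f w) * (\int[k (f w)]_z h z) + K)%:E)%E.
  have bXh : bounded_mfun (fun z => X (f w) * h z).
    by apply: bounded_mfunM => //; exact: bounded_mfun_cst.
  rewrite -[LHS]fineK; last first.
    by apply: integrable_fin_num => //; exact/bounded_mfun_integrable/bK.
  congr EFin; rewrite -[LHS]/(\int[k (f w)]_z (X (f w) * h z + K))%R.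
  rewrite RintegralD//; try by apply: bounded_mfun_integrable => //; exact: bounded_mfun_cst.
  rewrite Rintegral_probability_cst RintegralZl//; exact: bounded_mfun_integrable.
apply: ge0_le_integral => //.
- move=> w _; rewrite lee_fin; have := ZN w; rewrite ler_norml => /andP[+ _].
  have : N <= K by rewrite /K le_max lexx orbT.
  by lra.
- by apply/measurable_EFinP; exact: (bK _ _ _ bZ).1.
(* [k] is packed as a probability kernel to get measurability of the inner integral in [s]. *)
- have mS : measurable_fun setT (fun s => \int[k s]_z F (s, z))%E.
    pose ker (s : S) : {measure set Y -> \bar R} := k s.
    pose kk : R.-pker S ~> Y := HB.pack ker (isKernel.Build _ _ _ _ _ ker mk)
      (Kernel_isProbability.Build _ _ _ _ _ ker (fun s => probability_setT (k s))).
    exact: (measurable_fun_integral_finite_kernel (fun x => F x) kk).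
  exact: measurableT_comp mS mf.
- by move=> w _; rewrite inner lee_fin lerD2r.
Qed.

End conditional_inequality.

(** * Borel measurability on row vectors *)

Section borel_row_vectors.
Context (R : realType) (d : nat).

Lemma measurable_open_rV (A : set 'rV[R]_d) : open A -> measurable A.
Proof. exact: sub_sigma_algebra. Qed.

Lemma continuous_measurable_rV (f : 'rV[R]_d -> R) :
  continuous f -> measurable_fun setT f.
Proof.
move=> /continuousP cf; apply: (measurability _ (RGenOpens.measurableE R)).
move=> _ [_ [a [b ->] <-]]; rewrite setTI; apply: measurable_open_rV.
exact/cf/interval_open.
Qed.

Lemma measurable_coord_rV (i : 'I_d) :
  measurable_fun setT (fun x : 'rV[R]_d => x 0 i).
Proof. by apply: continuous_measurable_rV; exact: coord_continuous. Qed.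

(* An open set is the countable union of the rational boxes it contains. *)
Lemma measurable_rV (dT : measure_display) (T : measurableType dT)
    (Y : T -> 'rV[R]_d) :
  (forall i, measurable_fun setT (fun x => Y x 0 i)) -> measurable_fun setT Y.
Proof.
move=> mY; apply: (@measurability _ _ _ _ setT Y (@openRV R d) erefl) => _ [U oU <-].
rewrite setTI.
pose box (b : 'rV[rat]_d * nat) : set 'rV[R]_d :=
  [set x | forall i, `|x 0 i - ratr (b.1 0 i)| < b.2.+1%:R^-1].
(* Codes of no box, or of a box not contained in [U], contribute [set0]. *)
pose F (n : nat) : set T := if unpickle n is Some b then
  if `[< box b `<=` U >] then Y @^-1` (box b) else set0 else set0.
have -> : Y @^-1` U = \bigcup_n F n.
  apply/seteqP; split => [x /= Ux|x [n _]]; last first.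
    by rewrite /F; case: (unpickle n) => // b; case: asboolP => // bU /bU.
  have /nbhs_ballP[e /= e0 eU] := open_nbhs_nbhs (conj oU Ux).
  (* The box has radius below [e / 2] and its centre is within that radius of [Y x], so it lies in
     the [e]-ball around [Y x]. *)
  have [r re] : exists r : nat, r.+1%:R^-1 < e / 2.
    have e20 : 0 < e / 2 by rewrite divr_gt0.
    exists (Num.truncn (e / 2)^-1); rewrite invf_plt ?posrE//.
    exact: truncnS_gt.
  have r0 : 0 < r.+1%:R^-1 :> R by rewrite invr_gt0.
  move: r0 re; set rho := r.+1%:R^-1 => r0 re.
  have /choice[q qP] : forall i, exists q : rat, `|Y x 0 i - ratr q| < rho.
    move=> i; have : Y x 0 i - rho < Y x 0 i + rho by lra.
    move=> /rat_in_itvoo[q]; rewrite in_itv/= => /andP[q1 q2]; exists q.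
    by rewrite ltr_norml; apply/andP; split; lra.
  exists (pickle (\row_i q i, r)) => //; rewrite /F pickleK.
  rewrite asboolT; first by move=> i /=; rewrite mxE; exact: qP.
  move=> z zb; apply: eU; split => // i0 j; rewrite (ord1 i0) /ball/=.
  have := zb j; have := qP j; rewrite /= mxE ; rewrite -/rho => h1 h2.
  rewrite (_ : _ - _ = (Y x 0 j - ratr (q j)) - (z 0 j - ratr (q j))); last by ring.
  apply: le_lt_trans (ler_normB _ _) _; lra.
apply: bigcupT_measurable => n; rewrite /F; case: (unpickle n) => // b.
case: asboolP => // _.
rewrite (_ : _ @^-1` _ = \bigcap_(i in setT)
  ((fun x => `|Y x 0 i - ratr (b.1 0 i)| < b.2.+1%:R^-1) @^-1` [set true])); last first.
  by apply/seteqP; split => x /= h i; [move=> _|]; exact: h.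
apply: fin_bigcap_measurable => // i _; rewrite -[X in measurable X]setTI.
apply: measurable_fun_ltr => //.
apply: measurableT_comp => //; exact: measurable_funB.
Qed.

Lemma measurable_continuous_comp_rV (dT : measure_display)
    (T : measurableType dT) (f : 'rV[R]_d -> R) (Y : T -> 'rV[R]_d) :
  continuous f -> (forall i, measurable_fun setT (fun x => Y x 0 i)) ->
  measurable_fun setT (fun x => f (Y x)).
Proof.
move=> /continuous_measurable_rV mf /measurable_rV mY.
exact: measurableT_comp.
Qed.

End borel_row_vectors.

(** * Smoothness and the descent lemma *)

Section descent.
Context (R : realType) (d : nat).

Lemma lqnorm_ge0 (q : R) (x : 'rV[R]_d) : 0 <= lqnorm q x.
Proof. exact: powR_ge0. Qed.

Lemma lqnorm2_sqr (x : 'rV[R]_d) : lqnorm 2 x ^+ 2 = \sum_i x 0 i ^+ 2.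
Proof.
rewrite /lqnorm -powR_mulrn ?powR_ge0// -powRrM mulVf// powRr1.
  by apply: eq_bigr => i _; rewrite powR_mulrn// real_normK// num_real.
by apply: sumr_ge0 => i _; exact: powR_ge0.
Qed.

(** The difference quotient along the line is that of [L] at [x + s *: v] in direction [v];
    linearity of the differential expands it in coordinates. *)
Lemma is_derive_line (L : 'rV[R]_d -> R) (x v : 'rV[R]_d) (s : R) :
  (forall z, differentiable L z) ->
  is_derive s 1 (fun r => L (x + r *: v))
    (\sum_i grad L (x + s *: v) 0 i * v 0 i).
Proof.
move=> dL.
have E : (fun h : R => h^-1 *: (((fun r => L (x + r *: v)) \o shift s) (h *: 1)
      - L (x + s *: v))) =
    (fun h => h^-1 *: ((L \o shift (x + s *: v)) (h *: v) - L (x + s *: v))).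
  apply/funext => h /=; congr (_ *: (L _ - _)).
  by rewrite [h *: 1]mulr1 scalerDl addrCA.
apply: DeriveDef.
  rewrite /derivable; rewrite E; exact: (@diff_derivable _ _ _ L).
rewrite /derive E -/(derive L (x + s *: v) v) deriveE//.
move: (x + s *: v) => y; rewrite [in LHS](row_sum_delta v) linear_sum; apply: eq_bigr => i _.
by rewrite linearZ /grad mxE deriveE// mulrC.
Qed.

(** Subtracting the linear and quadratic terms along the segment leaves [psi], whose derivative is
    nonpositive on the open unit interval; the mean value theorem concludes without integrating the
    gradient. *)
Lemma descent_lemma (L : 'rV[R]_d -> R) (H : R) (x v : 'rV[R]_d) :
  0 < H -> (forall z, differentiable L z) ->
  (forall y z, lqnorm 2 (grad L y - grad L z) <= H * lqnorm 2 (y - z)) ->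
  L (x + v) <= L x + \sum_i grad L x 0 i * v 0 i + H / 2 * \sum_i v 0 i ^+ 2.
Proof.
move=> H0 dL lip.
set S := \sum_i v 0 i ^+ 2; set a := \sum_i grad L x 0 i * v 0 i.
pose psi (s : R) : R := L (x + s *: v) - s * a - s ^+ 2 * (H / 2 * S).
pose dpsi (s : R) : R := \sum_i grad L (x + s *: v) 0 i * v 0 i - a - 2 * s * (H / 2 * S).
have dpsiP (s : R) : is_derive s 1 psi (dpsi s).
  have h0 := is_derive_line x v s dL.
  have h1 : is_derive s 1 (fun r : R => r * a) a.
    rewrite (_ : (fun r => r * a) = a \*: id); last by apply/funext => r /=; rewrite mulrC.
    by apply: is_derive_eq; rewrite [LHS]mulr1.
  have h2 : is_derive s 1 (fun r : R => r ^+ 2 * (H / 2 * S)) (2 * s * (H / 2 * S)).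
    rewrite (_ : (fun r => _) = (H / 2 * S) \*: (id ^+ 2)); last first.
      by apply/funext => r /=; rewrite mulrC; congr (_ * _); rewrite fctE.
    apply: is_derive_eq; rewrite /= expr1 scaler1.
    by rewrite [LHS]mulrC.
  exact: (is_deriveB (is_deriveB h0 h1) h2).
have cpsi : {within `[0, 1], continuous psi}.
  apply: derivable_within_continuous => r _; exact: ex_derive.
have [s s01 e] : exists2 s, s \in `]0, 1[%R & psi 1 - psi 0 = dpsi s * (1 - 0).
  by apply: MVT => //.
suff : dpsi s <= 0.
  move: e; rewrite /psi !scale1r !scale0r addr0 subr0 mulr1 expr1n expr0n/=.
  by rewrite !mul0r !mul1r !subr0 => <-; lra.
move: s01; rewrite in_itv/= => /andP[s0 _].
rewrite /dpsi /a -sumrB.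
have Hs0 : 0 < H * s by rewrite mulr_gt0.
pose D i := grad L (x + s *: v) 0 i - grad L x 0 i.
(* Young's inequality with weight [H * s]: as the squares of [D] sum to at most [(H * s) ^+ 2 * S],
   each of the two terms then sums to at most [H * s / 2 * S]. *)
have amgm i : D i * v 0 i <= (2 * (H * s))^-1 * D i ^+ 2 + (H * s) / 2 * v 0 i ^+ 2.
  rewrite -subr_ge0 (_ : _ - _ = (2 * (H * s))^-1 * (D i - H * s * v 0 i) ^+ 2).
    by rewrite mulr_ge0 ?sqr_ge0// invr_ge0 mulr_ge0// ltW.
  by field; rewrite gt_eqF ?gt_eqF.
have SD : \sum_i D i ^+ 2 <= (H * s) ^+ 2 * S.
  have := lip (x + s *: v) x.
  rewrite [X in _ <= _ * lqnorm 2 X](_ : _ = s *: v); last by rewrite addrAC subrr add0r.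
  move=> h.
  have -> : \sum_i D i ^+ 2 = lqnorm 2 (grad L (x + s *: v) - grad L x) ^+ 2.
    rewrite lqnorm2_sqr; apply: eq_bigr => i _.
    by rewrite [in RHS]mxE [(- grad L x) 0 i]mxE.
  have -> : (H * s) ^+ 2 * S = (H * lqnorm 2 (s *: v)) ^+ 2.
    rewrite (exprMn _ H (lqnorm _ _)) lqnorm2_sqr (exprMn _ H s) -mulrA.
    congr (_ * _); rewrite mulr_sumr; apply: eq_bigr => i _.
    by rewrite [in RHS]mxE (exprMn _ s).
  by apply: lerXn2r; rewrite ?nnegrE ?mulr_ge0 ?lqnorm_ge0// ltW.
have : \sum_i D i * v 0 i <= (2 * (H * s))^-1 * ((H * s) ^+ 2 * S) + (H * s) / 2 * S.
  apply: (@le_trans _ _ (\sum_i ((2 * (H * s))^-1 * D i ^+ 2 + (H * s) / 2 * v 0 i ^+ 2))).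
    by apply: ler_sum => i _; exact: amgm.
  rewrite big_split/= -!mulr_sumr lerD2r ler_pM2l ?invr_gt0 ?mulr_gt0//.
rewrite (_ : _ * _ + _ = 2 * s * (H / 2 * S)); last first.
  by field; rewrite gt_eqF ?gt_eqF.
under eq_bigr do rewrite mulrBl.
by move=> ?; lra.
Qed.

End descent.

(** * Deterministic estimates along one trajectory *)

Section pathwise.
Context (R : realType) (d : nat).

Lemma phi_le1 (p z : R) : 0 < p -> `|z| <= 1 -> `|phi p z| <= 1.
Proof.
move=> p0 z1; rewrite /phi normrM ger0_norm ?powR_ge0// -[leRHS]mulr1.
apply: ler_pM => //.
  have := @ge0_ler_powR R p (ltW p0) `|z| 1; rewrite powR1; apply; rewrite ?nnegrE//.
by rewrite normr_sg; case: (z != 0).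
Qed.

Lemma adagrad_vE (p : R) (G : nat -> 'rV[R]_d) t i :
  adagrad_v p G t 0 i = \sum_(1 <= s < t.+1) phi p (G s 0 i) ^+ 2.
Proof. by rewrite /adagrad_v summxE; apply: eq_bigr => s _; rewrite !mxE. Qed.

Lemma adagrad_vS (p : R) (G : nat -> 'rV[R]_d) t i :
  adagrad_v p G t.+1 0 i = adagrad_v p G t 0 i + phi p (G t.+1 0 i) ^+ 2.
Proof. by rewrite !adagrad_vE big_nat_recr. Qed.

Lemma adagrad_v_ge0 (p : R) (G : nat -> 'rV[R]_d) t i : 0 <= adagrad_v p G t 0 i.
Proof. by rewrite adagrad_vE; apply: sumr_ge0 => s _; exact: sqr_ge0. Qed.

Lemma adagrad_v_le (p : R) (G : nat -> 'rV[R]_d) T i :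
  (forall t, (1 <= t <= T)%N -> `|phi p (G t 0 i)| <= 1) ->
  forall t, (t <= T)%N -> adagrad_v p G t 0 i <= t%:R.
Proof.
move=> b1 t tT; rewrite adagrad_vE.
apply: (@le_trans _ _ (\sum_(1 <= s < t.+1) 1)).
  apply: ler_sum_nat => s /andP[s1 st]; rewrite -real_normK ?num_real//.
  by rewrite expr_le1// b1// s1 (leq_trans _ tT).
by rewrite big_const_nat iter_addr_0 subn1.
Qed.

(** Time 0 is meaningful: the sum is then empty and the scale is the inverse square root of
    [eps]. *)
Definition step_scale (eps p : R) (G : nat -> 'rV[R]_d) (t : nat) (i : 'I_d) : R :=
  (Num.sqrt (adagrad_v p G t 0 i + eps))^-1.

Lemma step_scale_gt0 (eps p : R) (G : nat -> 'rV[R]_d) t i : 0 < eps ->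
  0 < step_scale eps p G t i.
Proof.
by move=> e0; rewrite invr_gt0 sqrtr_gt0 ltr_wpDl// adagrad_v_ge0.
Qed.

Lemma step_scale_le (eps p : R) (G : nat -> 'rV[R]_d) t i : 0 < eps ->
  step_scale eps p G t i <= (Num.sqrt eps)^-1.
Proof.
move=> e0; have := adagrad_v_ge0 p G t i => v0.
by rewrite lef_pV2 ?posrE ?sqrtr_gt0 ?ler_wsqrtr//; lra.
Qed.

Lemma step_scale_ge (eps p : R) (G : nat -> 'rV[R]_d) T i : 0 < eps ->
  (forall t, (1 <= t <= T)%N -> `|phi p (G t 0 i)| <= 1) ->
  forall t, (t <= T)%N -> (Num.sqrt (T%:R + eps))^-1 <= step_scale eps p G t i.
Proof.
move=> e0 b1 t tT; have v0 := adagrad_v_ge0 p G t i.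
have vT := adagrad_v_le b1 tT; have tTR : t%:R <= T%:R :> R by rewrite ler_nat.
by rewrite lef_pV2 ?posrE ?sqrtr_gt0 ?ler_wsqrtr//; lra.
Qed.

Lemma step_scale_nincr (eps p : R) (G : nat -> 'rV[R]_d) t i : 0 < eps ->
  step_scale eps p G t.+1 i <= step_scale eps p G t i.
Proof.
move=> e0; have v0 := adagrad_v_ge0 p G t i; rewrite /step_scale adagrad_vS.
have u0 := sqr_ge0 (phi p (G t.+1 0 i)).
by rewrite lef_pV2 ?posrE ?sqrtr_gt0 ?ler_wsqrtr//; lra.
Qed.

(** This is [ln u <= u - 1] at [u = x / (x + y)]. *)
Lemma le_ln_sub (x y : R) : 0 < x -> 0 <= y -> y / (x + y) <= ln (x + y) - ln x.
Proof.
move=> x0 y0; have xy0 : 0 < x + y by lra.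
have := @le_ln1Dx R (x / (x + y) - 1); rewrite addrCA subrr addr0.
rewrite ln_div ?posrE// => h.
have : -1 < x / (x + y) - 1.
  by have := divr_gt0 x0 xy0; lra.
move=> /h.
have -> : x / (x + y) - 1 = - (y / (x + y)) by field; rewrite gt_eqF.
by lra.
Qed.

(** [le_ln_sub] with the old accumulator plus [eps] as [x] and the new square as [y]. *)
Lemma sqr_step_le (eps p : R) (G : nat -> 'rV[R]_d) t i : 0 < eps ->
  phi p (G t.+1 0 i) ^+ 2 * step_scale eps p G t.+1 i ^+ 2 <=
  ln (adagrad_v p G t.+1 0 i + eps) - ln (adagrad_v p G t 0 i + eps).
Proof.
move=> e0; have v0 := adagrad_v_ge0 p G t i.
have u0 := sqr_ge0 (phi p (G t.+1 0 i)).
have := @le_ln_sub (adagrad_v p G t 0 i + eps) (phi p (G t.+1 0 i) ^+ 2).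
have -> : adagrad_v p G t 0 i + eps + phi p (G t.+1 0 i) ^+ 2 =
    adagrad_v p G t.+1 0 i + eps by rewrite adagrad_vS addrAC.
move=> h; rewrite /step_scale exprVn sqr_sqrtr.
  by apply: h => //; lra.
by rewrite addr_ge0// ?adagrad_v_ge0// ltW.
Qed.

(** The sum starts at [s = 0], so the gradient of time [s.+1] meets the scale of time [s], which
    involves only [G 1] to [G s]. *)
Lemma adagrad_pathwise (L : 'rV[R]_d -> R) (Lstar H eta eps p : R)
    (G Theta : nat -> 'rV[R]_d) (T : nat) :
  0 < H -> 0 < eta -> 0 < eps -> (forall z, differentiable L z) ->
  (forall y z, lqnorm 2 (grad L y - grad L z) <= H * lqnorm 2 (y - z)) ->
  (forall z, Lstar <= L z) -> (forall z i, `|grad L z 0 i| <= 1) ->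
  adagrad_power eta eps p G Theta ->
  (forall t i, (1 <= t <= T)%N -> `|phi p (G t 0 i)| <= 1) ->
  eta * (\sum_(s < T) \sum_i grad L (Theta s.+1) 0 i * step_scale eps p G s i
         * phi p (G s.+1 0 i)) <=
  L (Theta 1%N) - Lstar + eta * (d%:R / Num.sqrt eps)
  + H * eta ^+ 2 / 2 * (d%:R * ln (1 + T%:R / eps)).
Proof.
move=> H0 eta0 eps0 dL lip Ls g1 alg b1.
pose a t i := step_scale eps p G t i.
pose l t i := ln (adagrad_v p G t 0 i + eps).
(* A potential: its two corrections absorb the change of scale and the second-order term, so each
   step lowers it by at least [eta] times the inner product taken with the earlier scale. *)
pose Psi t := L (Theta t.+1) + eta * (\sum_i a t i)
  - H * eta ^+ 2 / 2 * (\sum_i l t i).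
have stepP s : (s < T)%N ->
    eta * (\sum_i grad L (Theta s.+1) 0 i * a s i * phi p (G s.+1 0 i)) <=
    Psi s - Psi s.+1.
  move=> sT; have := alg s.+1 isT.
  set v := (X in _ = _ - eta *: X) => E.
  have vE i : (- (eta *: v)) 0 i = - eta * (phi p (G s.+1 0 i) * a s.+1 i).
    by rewrite !mxE mulNr.
  have := descent_lemma (Theta s.+1) (- (eta *: v)) H0 dL lip; rewrite -E.
  have -> : \sum_i grad L (Theta s.+1) 0 i * (- (eta *: v)) 0 i =
      - eta * \sum_i grad L (Theta s.+1) 0 i * (phi p (G s.+1 0 i) * a s.+1 i).
    by rewrite mulr_sumr; apply: eq_bigr => i _; rewrite vE; ring.
  have -> : \sum_i (- (eta *: v)) 0 i ^+ 2 =
      eta ^+ 2 * \sum_i (phi p (G s.+1 0 i) ^+ 2 * a s.+1 i ^+ 2).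
    by rewrite mulr_sumr; apply: eq_bigr => i _; rewrite vE; ring.
  set S1 := \sum_i grad _ _ _ _ * (_ * _); set S2 := \sum_i _ ^+ 2 * _.
  have le2 : S2 <= \sum_i l s.+1 i - \sum_i l s i.
    by rewrite -sumrB; apply: ler_sum => i _; exact: sqr_step_le.
  (* The descent lemma yields the scale after the update; exchanging it costs a nonnegative
     difference of scales times a product of absolute value at most 1. *)
  have le1 : \sum_i grad L (Theta s.+1) 0 i * a s i * phi p (G s.+1 0 i) - S1 <=
      \sum_i a s i - \sum_i a s.+1 i.
    rewrite -!sumrB; apply: ler_sum => i _.
    rewrite (_ : _ - _ = (grad L (Theta s.+1) 0 i * phi p (G s.+1 0 i))
      * (a s i - a s.+1 i)); last by ring.
    rewrite -[leRHS]mul1r ler_wpM2r ?subr_ge0 ?step_scale_nincr//.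
    by rewrite (le_trans (ler_norm _))// normrM mulr_ile1// b1.
  have HE : 0 <= H * eta ^+ 2 / 2 by rewrite !mulr_ge0 ?sqr_ge0// ltW.
  have := ler_wpM2l HE le2; have := ler_wpM2l (ltW eta0) le1.
  rewrite /Psi !mulrBr => h1 h2 h3.
  rewrite (_ : H / 2 * (eta ^+ 2 * S2) = H * eta ^+ 2 / 2 * S2) in h3; last by ring.
  lra.
have : eta * (\sum_(s < T) \sum_i grad L (Theta s.+1) 0 i * a s i * phi p (G s.+1 0 i))
    <= Psi 0%N - Psi T.
  rewrite mulr_sumr (le_trans (ler_sum _ (fun i _ => stepP _ (ltn_ord i))))//.
  rewrite -(big_mkord xpredT (fun s => Psi s - Psi s.+1)).
  have -> : \sum_(0 <= s < T) (Psi s - Psi s.+1) = \sum_(0 <= s < T) - (Psi s.+1 - Psi s).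
    by apply: eq_bigr => s _; rewrite (opprB (Psi s.+1)).
  by rewrite sumrN telescope_sumr// opprB.
move=> /le_trans; apply.
rewrite /Psi.
have a0 : \sum_i a 0%N i <= d%:R / Num.sqrt eps.
  rewrite -[d in leRHS]card_ord -sum1_card natr_sum mulr_suml.
  by apply: ler_sum => i _; rewrite mul1r step_scale_le.
have aT : 0 <= \sum_i a T i.
  by apply: sumr_ge0 => i _; rewrite ltW// step_scale_gt0.
(* The accumulator is 0 at time 0 and at most [T] at time [T], so each coordinate contributes at
   most [ln ((T + eps) / eps)]. *)
have lT : \sum_i l T i - \sum_i l 0%N i <= d%:R * ln (1 + T%:R / eps).
  rewrite -sumrB -[d in leRHS]card_ord -sum1_card natr_sum mulr_suml.
  apply: ler_sum => i _; rewrite mul1r /l [adagrad_v p G 0 0 i]adagrad_vE big_geq// add0r.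
  have v0 := adagrad_v_ge0 p G T i.
  have vT : adagrad_v p G T 0 i <= T%:R.
    by apply: (adagrad_v_le (T := T)) => // t; exact: b1.
  have T0 : 0 <= T%:R :> R by [].
  rewrite -ln_div ?posrE//; last by lra.
  rewrite ler_ln ?posrE; first last.
  - by rewrite ltr_pwDl// divr_ge0// ltW.
  - by rewrite divr_gt0//; lra.
  by rewrite mulrDl divff ?gt_eqF// addrC lerD2l ler_pM2r// invr_gt0.
have HE : 0 <= H * eta ^+ 2 / 2 by rewrite !mulr_ge0 ?sqr_ge0// ltW.
have := ler_wpM2l HE lT; rewrite mulrBr.
have := ler_wpM2l (ltW eta0) a0; have := mulr_ge0 (ltW eta0) aT.
have := Ls (Theta T.+1).
by move=> ? ? ? ?; lra.
Qed.

End pathwise.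

(** * Norm comparisons and continuity of the gradient *)

Section coordinates.
Context (R : realType) (d : nat).

Lemma norm_coord_le (x : 'rV[R]_d) i : `|x 0 i| <= `|x|.
Proof.
rewrite [leRHS](_ : _ = mx_norm x)// mx_normrE.
exact: (le_bigmax _ (fun ij : 'I_1 * 'I_d => `|x ij.1 ij.2|) (0, i)).
Qed.

Lemma lqnorm_expE (q : R) (x : 'rV[R]_d) : q != 0 ->
  lqnorm q x `^ q = \sum_i `|x 0 i| `^ q.
Proof.
move=> q0; rewrite /lqnorm -powRrM mulVf// powRr1//.
by apply: sumr_ge0 => i _; exact: powR_ge0.
Qed.

Lemma coord_le_lqnorm2 (x : 'rV[R]_d) i : `|x 0 i| <= lqnorm 2 x.
Proof.
rewrite -(@ler_pXn2r _ 2)// ?nnegrE ?lqnorm_ge0//.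
rewrite lqnorm2_sqr real_normK ?num_real// (bigD1 i)//= lerDl.
by apply: sumr_ge0 => j _; exact: sqr_ge0.
Qed.

(** The crude factor [d], instead of its square root, is enough for continuity. *)
Lemma lqnorm2_le (x : 'rV[R]_d) (r : R) : 0 <= r -> (forall i, `|x 0 i| <= r) ->
  lqnorm 2 x <= d%:R * r.
Proof.
move=> r0 xr; rewrite -(@ler_pXn2r _ 2)// ?nnegrE ?lqnorm_ge0 ?mulr_ge0//.
rewrite lqnorm2_sqr exprMn.
apply: (@le_trans _ _ (\sum_(i < d) r ^+ 2)).
  apply: ler_sum => i _; rewrite -real_normK ?num_real//.
  by apply: lerXn2r; rewrite ?nnegrE.
rewrite sumr_const card_ord -[leLHS]mulr_natl ler_wpM2r ?sqr_ge0//.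
by rewrite -natrX ler_nat; case: (d) => // n; rewrite -mulnn leq_pmull.
Qed.

(** The topology is that of the max norm while the Lipschitz bound is in the Euclidean norm;
    [coord_le_lqnorm2] and [lqnorm2_le] pass between the two. *)
Lemma lipschitz_grad_continuous (L : 'rV[R]_d -> R) (H : R) i :
  (forall y z, lqnorm 2 (grad L y - grad L z) <= H * lqnorm 2 (y - z)) ->
  0 < H -> continuous (fun z => grad L z 0 i).
Proof.
move=> lip H0 /= y s /= /(nbhs_ballP (grad L y 0 i)) [e /= e0 es].
(* With [d%:R + 1] the divisor is positive without a case analysis on [d]. *)
have K0 : 0 < H * (d%:R + 1) by rewrite mulr_gt0// ltr_wpDl.
apply/nbhs_ballP; exists (e / 2 / (H * (d%:R + 1))) => /=; first by rewrite !divr_gt0.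
move=> z [_ yz0]; apply: es; rewrite /ball/=.
have yz j : `|(y - z) 0 j| <= e / 2 / (H * (d%:R + 1)).
  by rewrite !mxE ltW//; exact: yz0.
have := coord_le_lqnorm2 (grad L y - grad L z) i.
rewrite [(grad L y - _) 0 i]mxE [(- grad L z) 0 i]mxE => h.
apply: le_lt_trans h _; apply: le_lt_trans (lip y z) _.
have r0 : 0 <= e / 2 / (H * (d%:R + 1)) by rewrite !divr_ge0// ltW.
have := lqnorm2_le r0 yz => /(ler_wpM2l (ltW H0)) h.
apply: le_lt_trans h _.
rewrite mulrA [ltLHS](_ : _ = e / 2 * (H * d%:R / (H * (d%:R + 1)))); last by ring.
apply: (@le_lt_trans _ _ (e / 2 * 1)); last by lra.
rewrite ler_pM2l; last by lra.
by rewrite ler_pdivrMr// mul1r ler_pM2l// lerDl.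
Qed.

End coordinates.

(** * Measurability and truncation of [phi] *)

Section clipped_phi.
Context (R : realType).

Lemma measurable_phi (p : R) : measurable_fun setT (phi p).
Proof.
apply: measurable_funM.
  by apply: (measurableT_comp (measurable_powR p)); exact: normr_measurable.
rewrite (_ : Num.sg = fun x : R => if x == 0 then 0 else if x < 0 then -1 else 1).
  apply: measurable_fun_ifT => //.
    exact: measurable_fun_eqr.
  by apply: measurable_fun_ifT => //; exact: measurable_fun_ltr.
by apply/funext => x; case: sgrP => // [|x0]; rewrite ?ltxx// ltNge ltW.
Qed.

(** Truncation to [-1, 1] gives a function bounded everywhere, as [bounded_mfun] requires; by
    [clip_phi_id] it agrees with [phi] wherever the gradient coordinates are at most 1 in absolute
    value. *)
Definition clip_phi (p z : R) : R := Num.max (-1) (Num.min 1 (phi p z)).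

Lemma clip_phi_id (p z : R) : `|phi p z| <= 1 -> clip_phi p z = phi p z.
Proof. by rewrite ler_norml /clip_phi => /andP[h1 h2]; rewrite min_r// max_r. Qed.

Lemma bounded_mfun_clip_phi (p : R) : bounded_mfun (clip_phi p).
Proof.
split.
  by apply: measurable_maxr => //; apply: measurable_minr => //; exact: measurable_phi.
exists 1 => z; rewrite ler_norml /clip_phi le_max lexx/= ge_max ge_min lexx/= andbT.
lra.
Qed.

End clipped_phi.

(** * Expectations under the gradient oracle *)

Section oracle.
Context (R : realType) (d : nat) (p : R) (L : 'rV[R]_d -> R) (dX : measure_display)
  (Xi : measurableType dX) (Q : probability Xi R) (y : Xi -> 'rV[R]_d).
Hypothesis my : measurable_fun setT y.
Hypothesis y1 : {ae Q, forall x, `|y x| <= 1}.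

Let my_coord i : measurable_fun setT (fun x => y x 0 i).
Proof. exact: measurableT_comp (measurable_coord_rV i) my. Qed.

Lemma ae_coord_le1 i : {ae Q, forall x, `|y x 0 i| <= 1}.
Proof. by apply: filterS y1 => x; exact: le_trans (norm_coord_le _ _). Qed.

(** The almost sure bound passes to the mean. For an unbiased oracle this bounds every partial
    derivative of the objective by 1. *)
Lemma expectation_coord_le1 i (a : R) : ('E_Q[fun x => (y x 0 i)%R] = a%:E)%E -> `|a| <= 1.
Proof.
rewrite unlock => E; rewrite -lee_fin -abse_EFin -E.
have mE : measurable_fun setT (fun x => (y x 0 i)%:E) by exact/measurable_EFinP.
apply: le_trans (le_abse_integral _ _ mE) _ => //.
have := @integral_le_bound _ _ _ Q setT (fun x => (y x 0 i)%:E) 1%E measurableT mE.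
rewrite [X in (_ * X)%E](_ : _ = 1%E) ?mule1; last exact: probability_setT.
apply => //.
by apply: filterS (ae_coord_le1 i) => x h _; rewrite lee_fin.
Qed.

(** Truncation changes the integrand only on a null set, and the truncated integrand is integrable,
    so the expectation is a real number. *)
Lemma expectation_phi i : 0 < p ->
  ('E_Q[fun x => phi p (y x 0 i)%R] = (\int[Q]_x clip_phi p (y x 0 i))%R%:E)%E.
Proof.
move=> p0; rewrite unlock /Rintegral fineK.
  apply: ae_eq_integral => //.
  - by apply/measurable_EFinP; exact: measurableT_comp (measurable_phi p) _.
  - apply/measurable_EFinP; exact: measurableT_comp (bounded_mfun_clip_phi p).1 _.
  - apply: filterS (ae_coord_le1 i) => x h _.
    by rewrite clip_phi_id// phi_le1.
apply: integrable_fin_num => //; apply: bounded_mfun_integrable.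
exact: bounded_mfun_comp (bounded_mfun_clip_phi p) _.
Qed.

End oracle.

(** * Arithmetic of the rate *)

Section rate.
Context (R : realType).

(** The last factor on the right is [T] times the claimed rate with its constant unfolded; the left
    side has the form of the pathwise bound. *)
Lemma rate_bound (T : nat) (A B c eps eta : R) : (2 <= T)%N -> 0 <= A -> 0 <= B ->
  0 < c -> 0 < eps -> 0 < eta ->
  B + A * ln (1 + T%:R / eps) <= eta * (c / Num.sqrt (T%:R + eps)) *
    (T%:R * (Num.sqrt (1 + eps) / (c * eta)
      * ((B + A * ln (1 + eps^-1)) / ln 2 + A) * ln T%:R / Num.sqrt T%:R)).
Proof.
move=> T2 A0 B0 c0 eps0 eta0.
have T0 : 0 < T%:R :> R by rewrite ltr0n (leq_trans _ T2).
have T1 : 1 <= T%:R :> R by rewrite ler1n (leq_trans _ T2).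
have ln2 : 0 < ln 2 :> R by rewrite ln_gt0// ltr1n.
have lnT : ln 2 <= ln T%:R :> R by rewrite ler_ln ?posrE// ler_nat.
have e1 : 0 < eps^-1 by rewrite invr_gt0.
have le0 : 0 <= ln (1 + eps^-1) by rewrite ln_ge0// lerDl ltW.
(* From [1 + T / eps <= T + T / eps], as [T >= 1]. *)
have lnle : ln (1 + T%:R / eps) <= ln T%:R + ln (1 + eps^-1).
  rewrite -lnM ?posrE ?addr_gt0//; rewrite ler_ln ?posrE ?mulr_gt0 ?addr_gt0 ?divr_gt0//.
  by rewrite mulrDr mulr1 lerD2r.
set D := (B + A * ln (1 + eps^-1)) / ln 2 + A.
have N0 : 0 <= B + A * ln (1 + eps^-1) by rewrite addr_ge0// mulr_ge0.
have D0 : 0 <= D by rewrite addr_ge0// divr_ge0// ltW.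
have step1 : B + A * ln (1 + T%:R / eps) <= D * ln T%:R.
  have h1 : A * ln (1 + T%:R / eps) <= A * (ln T%:R + ln (1 + eps^-1)) by rewrite ler_wpM2l.
  (* Constant terms are absorbed into the logarithm because [ln T >= ln 2]. *)
  have h2 : B + A * ln (1 + eps^-1) <= (B + A * ln (1 + eps^-1)) / ln 2 * ln T%:R.
    by rewrite -mulrA ler_peMr// ler_pdivlMl// mulr1.
  by rewrite /D mulrDl; move: h1 h2; rewrite mulrDr; lra.
apply: le_trans step1 _.
set r := Num.sqrt T%:R * Num.sqrt (1 + eps) / Num.sqrt (T%:R + eps).
have sT : 0 < Num.sqrt T%:R :> R by rewrite sqrtr_gt0.
have sTe : 0 < Num.sqrt (T%:R + eps) by rewrite sqrtr_gt0 addr_gt0.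
(* [T + eps <= T * (1 + eps)]; this is why the constant carries the square root of [1 + eps]. *)
have r1 : 1 <= r.
  rewrite /r ler_pdivlMr// mul1r -sqrtrM ?ler0n// ler_wsqrtr//.
  by rewrite mulrDr mulr1 lerD2l ler_peMl// ltW.
rewrite [leRHS](_ : _ = r * (D * ln T%:R)); last first.
  rewrite /r; have -> : T%:R = Num.sqrt T%:R ^+ 2 :> R by rewrite sqr_sqrtr// ltW.
  rewrite sqrtr_sqr ger0_norm ?(ltW sT)//.
  by field; rewrite !gt_eqF// sqr_sqrtr// ltW.
by rewrite ler_peMl// mulr_ge0// ln_ge0.
Qed.

End rate.

(** * Measurability with respect to the past, and conditioning *)

Section run.
Context (R : realType) (d : nat) (eps eta p : R).
Context (dX : measure_display) (Xi : measurableType dX) (Q : probability Xi R)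
  (g : 'rV[R]_d -> Xi -> 'rV[R]_d).
Context (dO : measure_display) (Omega : measurableType dO)
  (P : probability Omega R) (G Theta : nat -> Omega -> 'rV[R]_d)
  (theta1 : 'rV[R]_d).
Hypothesis mg : forall theta, measurable_fun setT (g theta).
Hypothesis mG : forall t, (1 <= t)%N -> measurable_fun setT (G t).
Hypothesis law : forall t, (1 <= t)%N ->
  conditional_law P (past G t) (G t) (fun w B => Q (g (Theta t w) @^-1` B)).
Hypothesis init : forall w, Theta 1%N w = theta1.
Hypothesis alg : forall w, adagrad_power eta eps p (G ^~ w) (Theta ^~ w).
Hypotheses (eps_gt0 : 0 < eps) (p_gt0 : 0 < p).

(** The generators of [past], named separately because [g_sigma_algebraType] takes a generating
    family. *)
Definition past_gen t : set (set Omega) :=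
  [set A | exists s : nat, (1 <= s < t)%N /\
     exists2 B : set 'rV[R]_d, measurable B & A = G s @^-1` B].

(* Omega with the past before time t as its sigma-algebra. *)
Let S t := g_sigma_algebraType (past_gen t).

Let pastP t (A : set (S t)) : measurable A -> past G t A.
Proof. by []. Qed.

(** Each [G s] with [s >= 1] is measurable, so the past is a sub-sigma-algebra. *)
Let measurable_past_id t : measurable_fun setT (fun w : Omega => w : S t).
Proof.
move=> _ A mA; rewrite setTI; move: A mA.
apply: smallest_sub; first exact: sigma_algebra_measurable.
move=> _ [s [/andP[s1 _] [B mB ->]]].
by rewrite -[X in measurable X]setTI; exact: mG.
Qed.

Let measurable_past_G s t i : (1 <= s < t)%N ->
  measurable_fun setT (fun w : S t => G s w 0 i).
Proof.
move=> st; apply: (measurableT_comp (measurable_coord_rV i)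
  (_ : measurable_fun setT (G s : S t -> _))).
move=> _ B mB; rewrite setTI; apply: sub_sigma_algebra.
by exists s; split => //; exists B.
Qed.

Let measurable_past_step_scale s t i : (s < t)%N ->
  measurable_fun setT (fun w : S t => step_scale eps p (G ^~ w) s i).
Proof.
(* Written as a power with exponent -1/2, the scale is covered by the measurability of [powR]. *)
move=> st; rewrite (_ : (fun w => _) = (fun w =>
    (\sum_(r < s) phi p (G r.+1 w 0 i) ^+ 2 + eps) `^ (- 2^-1))); last first.
  apply/funext => w; rewrite /step_scale adagrad_vE big_add1 big_mkord.
  rewrite powRN powR12_sqrt//.
  by rewrite addr_ge0 ?(ltW eps_gt0)// sumr_ge0// => r _; exact: sqr_ge0.
apply: (measurableT_comp (measurable_powR _)); apply: measurable_funD => //.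
apply: measurable_sum => r; apply: measurable_funX.
apply: (measurableT_comp (measurable_phi p)).
by apply: measurable_past_G; rewrite /= (leq_ltn_trans (ltn_ord r)).
Qed.

(** Induction from the deterministic start: an iterate needs only the previous one, the gradient
    drawn there and its scale, all known before time [t]. *)
Let measurable_past_Theta s t i : (1 <= s <= t)%N ->
  measurable_fun setT (fun w : S t => Theta s w 0 i).
Proof.
elim: s => // -[_ /= t1|s ih /andP[_ st]].
  by under eq_fun do rewrite init; exact: measurable_cst.
rewrite (_ : (fun w => _) = (fun w : S t => Theta s.+1 w 0 i -
    eta * (phi p (G s.+1 w 0 i) * step_scale eps p (G ^~ w) s.+1 i))).
  apply: measurable_funB; first by apply: ih; rewrite /= ltnW.
  apply: measurable_funM => //; apply: measurable_funM.
    by apply: measurableT_comp (measurable_phi p) _; exact: measurable_past_G.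
  exact: measurable_past_step_scale.
by apply/funext => w; rewrite (alg w (isT : (0 < s.+1)%N)) !mxE.
Qed.

(** The oracle law at the current iterate, as a kernel on the past; its measurability is part of
    [conditional_law]. *)
Let kern t (w : S t) : probability 'rV[R]_d R := image_law Q (mg (Theta t w)).

Section step.
Variables (L : 'rV[R]_d -> R) (H c : R) (t : nat) (i : 'I_d).
Hypothesis lip : forall y z, lqnorm 2 (grad L y - grad L z) <= H * lqnorm 2 (y - z).
Hypothesis H_gt0 : 0 < H.
Hypothesis grad_le1 : forall z i, `|grad L z 0 i| <= 1.
Hypothesis t_gt0 : (1 <= t)%N.

Let bounded_past_grad : bounded_mfun (fun w : S t => grad L (Theta t w) 0 i).
Proof.
split; last by exists 1.
apply: (measurable_continuous_comp_rV (f := fun z => grad L z 0 i)).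
  exact: (lipschitz_grad_continuous lip).
by move=> j; apply: measurable_past_Theta; rewrite t_gt0 leqnn.
Qed.

Let bounded_past_step_scale :
  bounded_mfun (fun w : S t => step_scale eps p (G ^~ w) t.-1 i).
Proof.
split; first by apply: measurable_past_step_scale; rewrite prednK.
exists (Num.sqrt eps)^-1 => w.
by rewrite ger0_norm ?step_scale_le// ltW// step_scale_gt0.
Qed.

Lemma bounded_grad : bounded_mfun (fun w : Omega => grad L (Theta t w) 0 i).
Proof. exact: (bounded_mfun_comp bounded_past_grad (@measurable_past_id t)). Qed.

Lemma bounded_step_scale :
  bounded_mfun (fun w : Omega => step_scale eps p (G ^~ w) t.-1 i).
Proof.
exact: (bounded_mfun_comp bounded_past_step_scale (@measurable_past_id t)).
Qed.

Lemma bounded_grad_powR :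
  bounded_mfun (fun w : Omega => `|grad L (Theta t w) 0 i| `^ (p + 1)).
Proof.
have [mgr _] := bounded_grad; split.
  by apply: (measurableT_comp (measurable_powR _)); exact: measurableT_comp.
exists 1 => w; rewrite ger0_norm ?powR_ge0//.
have := @ge0_ler_powR R (p + 1) (addr_ge0 (ltW p_gt0) ler01).
by move=> /(_ `|grad L (Theta t w) 0 i| 1); rewrite powR1; apply; rewrite ?nnegrE.
Qed.

Lemma bounded_clip_phi : bounded_mfun (fun w : Omega => clip_phi p (G t w 0 i)).
Proof.
apply: (bounded_mfun_comp (bounded_mfun_clip_phi p)).
exact: (measurableT_comp (measurable_coord_rV i) (mG t_gt0)).
Qed.

(** The iterate and the scale of time [t.-1] belong to the past, so conditioning averages [G t]
    alone, under the oracle law at the current iterate, where the low-noise bound applies. *)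
Lemma conditional_low_noise :
  (forall theta, c * `|grad L theta 0 i| `^ (p + 1) <=
     (\int[Q]_x clip_phi p (g theta x 0 i))%R * grad L theta 0 i) ->
  (\int[P]_w (c * `|grad L (Theta t w) 0 i| `^ (p + 1)
     * step_scale eps p (G ^~ w) t.-1 i) <=
   \int[P]_w (grad L (Theta t w) 0 i * step_scale eps p (G ^~ w) t.-1 i
     * clip_phi p (G t w 0 i)))%R.
Proof.
move=> low.
have [mk jointlaw] : (forall B, measurable B ->
    measurable_fun setT (fun w : S t => kern w B)) /\
   (forall A B, measurable A -> measurable B ->
  (P ((fun w : Omega => w : S t) @^-1` A `&` G t @^-1` B) =
    \int[P]_(w in (fun w : Omega => w : S t) @^-1` A) @kern t w B)%E).
  split => [B mB|A B mA mB].
    by move=> _ D mD; rewrite setTI; exact: ((law t_gt0 mB).1 D mD).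
  exact: ((law t_gt0 mB).2 A (pastP mA)).
have bh : bounded_mfun (fun z : 'rV[R]_d => clip_phi p (z 0 i)).
  exact: bounded_mfun_comp (bounded_mfun_clip_phi p) (measurable_coord_rV i).
apply: (@le_Rintegral_disintegration _ _ _ _ _ _ _ _ _ _ _
   (@measurable_past_id t) (mG t_gt0) mk jointlaw
   (fun w => grad L (Theta t w) 0 i * step_scale eps p (G ^~ w) t.-1 i)
   (fun z => clip_phi p (z 0 i))) => //.
- exact: bounded_mfunM.
- apply: bounded_mfunM bounded_step_scale; apply: bounded_mfunM bounded_grad_powR.
  exact: bounded_mfun_cst.
- move=> w; rewrite [leRHS]mulrAC ler_wpM2r//; first by rewrite ltW// step_scale_gt0.
  rewrite [leRHS]mulrC; apply: le_trans (low _) _.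
  (* Change of variables from the oracle's sample space to its image law. *)
  rewrite (_ : Rintegral _ _ _ =
    Rintegral (@kern t w) setT (fun z => clip_phi p (z 0 i)))//.
  rewrite /Rintegral; congr fine.
  rewrite integral_distribution//.
    by apply/measurable_EFinP; exact: bh.1.
  apply: bounded_mfun_integrable; exact: bounded_mfun_comp bh (mg _).
Qed.

End step.

(** The offending set has oracle probability 0 at every iterate; the conditional law, tested on the
    whole space, carries this over to [G t]. *)
Lemma ae_gradient_le1 t i : (1 <= t)%N ->
  (forall theta, {ae Q, forall x, `|g theta x| <= 1}) ->
  {ae P, forall w, `|G t w 0 i| <= 1}.
Proof.
move=> t1 g1.
pose B : set 'rV[R]_d := [set y | ~ `|y 0 i| <= 1].
have mB : measurable B.
  rewrite (_ : B = ~` ((fun y : 'rV[R]_d => `|y 0 i| <= 1) @^-1` [set true])).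
    apply: measurableC; rewrite -[X in measurable X]setTI.
    apply: measurable_fun_ler => //; apply: measurableT_comp => //.
    exact: measurable_coord_rV.
  by apply/seteqP; split => y /=.
have mGB : measurable (G t @^-1` B).
  by rewrite -[X in measurable X]setTI; exact: mG.
apply/negligibleP => //.
rewrite -[X in _ X = _](setTI (G t @^-1` B)).
apply: etrans ((law t1 mB).2 setT (@measurableT _ (g_sigma_algebraType (past_gen t)))) _.
rewrite integral0_eq// => w _.
apply/negligibleP.
  by rewrite -[X in measurable X]setTI; exact: mg.
exact: (ae_coord_le1 (g1 (Theta t w)) i).
Qed.

End run.

(** * Convergence rate of the smallest expected gradient norm *)

Theorem theorem5p8 (R : realType) (d : nat) (Rb H eps eta p c Delta : R)
    (eps_gt0 : 0 < eps) (eta_gt0 : 0 < eta) (H_gt0 : 0 < H)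
    (Rb_gt0 : 0 < Rb) (Rb_lt1 : Rb < 1)
    (p_gt0 : 0 < p) (p_lt1 : p < 1) (c_gt0 : 0 < c) :
  exists C : R,
  forall (L : 'rV[R]_d -> R) (Lstar : R) (theta1 : 'rV[R]_d)
    (* the stochastic gradient oracle: g theta is a random vector on (Xi, Q) *)
    (dX : measure_display) (Xi : measurableType dX) (Q : probability Xi R)
    (g : 'rV[R]_d -> Xi -> 'rV[R]_d)
    (* the run of the algorithm, on (Omega, P) *)
    (dO : measure_display) (Omega : measurableType dO) (P : probability Omega R)
    (G Theta : nat -> Omega -> 'rV[R]_d),
    (forall theta, differentiable L theta) ->
    (forall theta, measurable_fun setT (g theta)) ->
    (forall theta (i : 'I_d),
       'E_Q[fun x => (g theta x 0 i)%R] = (grad L theta 0 i)%R%:E)%E ->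
    (forall theta, Lstar <= L theta) ->
    (forall theta theta', lqnorm 2 (grad L theta - grad L theta')
                          <= H * lqnorm 2 (theta - theta')) ->
    (forall theta, {ae Q, forall x, `|g theta x| + eps <= Rb}) ->
    (forall theta (i : 'I_d),
       (c * `|grad L theta 0 i| `^ (p + 1))%R%:E
       <= 'E_Q[fun x => phi p (g theta x 0 i)%R] * (grad L theta 0 i)%R%:E)%E ->
    (forall t, (1 <= t)%N -> measurable_fun setT (G t)) ->
    (forall t, (1 <= t)%N ->
       conditional_law P (past G t) (G t)
         (fun w B => Q (g (Theta t w) @^-1` B))) ->
    (forall w, Theta 1%N w = theta1) ->
    (forall w, adagrad_power eta eps p (G ^~ w) (Theta ^~ w)) ->
    L theta1 - Lstar = Delta ->
    forall T : nat, (2 <= T)%N ->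
      (\big[Order.min/+oo]_(1 <= t < T.+1)
         'E_P[fun w => (lqnorm (p + 1) (grad L (Theta t w)) `^ (p + 1))%R]
       <= (C * ln T%:R / Num.sqrt T%:R)%R%:E)%E.
Proof.
(* [A] and [B] collect the constants of [adagrad_pathwise], and [C] is the constant of [rate_bound];
   all are fixed before the objective, the oracle and the run. *)
pose A := H * eta ^+ 2 / 2 * d%:R.
pose B := Delta + eta * (d%:R / Num.sqrt eps).
pose C := Num.sqrt (1 + eps) / (c * eta) * ((B + A * ln (1 + eps^-1)) / ln 2 + A).
exists C => L Lstar theta1 dX Xi Q g dO Omega P G Theta dL mg Eg Ls lip gb low mG
  law init alg DeltaE T T2.
have g1 theta : {ae Q, forall x, `|g theta x| <= 1}.
  by apply: filterS (gb theta) => x h; lra.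
have grad1 z i : `|grad L z 0 i| <= 1.
  exact: (expectation_coord_le1 (mg z) (g1 z) (Eg z i)).
have low' theta i : c * `|grad L theta 0 i| `^ (p + 1) <=
    (\int[Q]_x clip_phi p (g theta x 0 i))%R * grad L theta 0 i.
  have := low theta i; rewrite (expectation_phi (mg theta) (g1 theta) i p_gt0).
  by rewrite -EFinM lee_fin.
pose Sg t w := \sum_i `|grad L (Theta t w) 0 i| `^ (p + 1).
pose Z t i w := c * `|grad L (Theta t w) 0 i| `^ (p + 1)
  * step_scale eps p (G ^~ w) t.-1 i.
pose W t i w := grad L (Theta t w) 0 i * step_scale eps p (G ^~ w) t.-1 i
  * clip_phi p (G t w 0 i).
have bgrad t i : (1 <= t)%N -> bounded_mfun (fun w => grad L (Theta t w) 0 i).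
  exact: (bounded_grad mG init alg eps_gt0 i lip H_gt0 grad1).
have bpow t i : (1 <= t)%N ->
    bounded_mfun (fun w => `|grad L (Theta t w) 0 i| `^ (p + 1)).
  exact: (bounded_grad_powR mG init alg eps_gt0 p_gt0 i lip H_gt0 grad1).
have bscale t i : (1 <= t)%N ->
    bounded_mfun (fun w => step_scale eps p (G ^~ w) t.-1 i).
  exact: (bounded_step_scale p mG eps_gt0).
have bSg t : (1 <= t)%N -> bounded_mfun (Sg t).
  by move=> t1; apply: bounded_mfun_sum => i _; exact: bpow.
have bZ t i : (1 <= t)%N -> bounded_mfun (Z t i).
  move=> t1; apply: bounded_mfunM (bscale _ _ t1).
  by apply: bounded_mfunM (bpow _ _ t1); exact: bounded_mfun_cst.
have bW t i : (1 <= t)%N -> bounded_mfun (W t i).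
  move=> t1; apply: bounded_mfunM; last exact: bounded_clip_phi.
  exact: bounded_mfunM (bgrad _ _ t1) (bscale _ _ t1).
have leZW t i : (1 <= t)%N -> (\int[P]_w Z t i w <= \int[P]_w W t i w)%R.
  move=> t1.
  exact: (conditional_low_noise mg mG law init alg eps_gt0 p_gt0 lip H_gt0 grad1 t1).
(* One almost sure event for all times and coordinates: a countable intersection over times of
   finite ones over coordinates. *)
have good : {ae P, forall w, forall t i, (1 <= t <= T)%N -> `|phi p (G t w 0 i)| <= 1}.
  have : {ae P, forall w, forall t i, `|G t.+1 w 0 i| <= 1}.
    apply/ae_foralln => t; apply: filter_forall => i.
    exact: (ae_gradient_le1 mg mG law).
  apply: filterS => w h [//|t] i _.
  exact: phi_le1.
(* On the event [good], [kappa] is a lower bound of [c] times every scale up to time [T]; [K] is the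
   pathwise bound divided by [eta]. *)
pose kappa := c / Num.sqrt (T%:R + eps).
pose K := (B + A * ln (1 + T%:R / eps)) / eta.
have aeSZ : {ae P, forall w, kappa * (\sum_(s < T) Sg s.+1 w) <=
    \sum_(s < T) \sum_i Z s.+1 i w}.
  apply: filterS good => w gw; rewrite mulr_sumr; apply: ler_sum => s _.
  rewrite /Sg mulr_sumr; apply: ler_sum => i _.
  rewrite /kappa /Z mulrAC ler_wpM2l//; first by rewrite mulr_ge0 ?powR_ge0// ltW.
  apply: (step_scale_ge eps_gt0 (fun t => gw t i)).
  exact: (ltnW (ltn_ord s)).
have aeWK : {ae P, forall w, \sum_(s < T) \sum_i W s.+1 i w <= K}.
  apply: filterS good => w gw; rewrite /K ler_pdivlMr// mulrC.
  have := adagrad_pathwise (T := T) H_gt0 eta_gt0 eps_gt0 dL lip Ls grad1 (alg w) gw.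
  rewrite init DeltaE mulrA -/B -/A; apply: le_trans.
  rewrite le_eqVlt; apply/orP; left; apply/eqP; congr (_ * _).
  apply: eq_bigr => s _; apply: eq_bigr => i _.
  by rewrite /W /= clip_phi_id// gw//= ltn_ord.
(* [Z] and [W] link the two ends: the outer comparisons are almost sure, while the middle one,
   [leZW], is between expectations, term by term. *)
have sumSg : kappa * \sum_(s < T) (\int[P]_w Sg s.+1 w)%R <= K.
  rewrite -Rintegral_sum; last by move=> s _; exact: bSg.
  rewrite -RintegralZl//; last first.
    by apply: bounded_mfun_integrable; apply: bounded_mfun_sum => s _; exact: bSg.
  have bZZ : bounded_mfun (fun w => \sum_(s < T) \sum_i Z s.+1 i w).
    by apply: bounded_mfun_sum => s _; apply: bounded_mfun_sum => i _; exact: bZ.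
  have bWW : bounded_mfun (fun w => \sum_(s < T) \sum_i W s.+1 i w).
    by apply: bounded_mfun_sum => s _; apply: bounded_mfun_sum => i _; exact: bW.
  apply: (@le_trans _ _ (\int[P]_w (\sum_(s < T) \sum_i Z s.+1 i w))%R).
    apply: bounded_mfun_le_Rintegral aeSZ => //.
    apply: bounded_mfunM; first exact: bounded_mfun_cst.
    by apply: bounded_mfun_sum => s _; exact: bSg.
  apply: (@le_trans _ _ (\int[P]_w (\sum_(s < T) \sum_i W s.+1 i w))%R).
    rewrite !Rintegral_sum; last 2 first.
    - by move=> s _; apply: bounded_mfun_sum => i _; exact: bW.
    - by move=> s _; apply: bounded_mfun_sum => i _; exact: bZ.
    apply: ler_sum => s _; rewrite !Rintegral_sum; last 2 first.
    - by move=> i _; exact: bW.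
    - by move=> i _; exact: bZ.
    by apply: ler_sum => i _; exact: leZW.
  rewrite -[leRHS](Rintegral_probability_cst P).
  by apply: bounded_mfun_le_Rintegral => //; exact: bounded_mfun_cst.
have expE t : (1 <= t)%N ->
    'E_P[fun w => (lqnorm (p + 1) (grad L (Theta t w)) `^ (p + 1))%R]%E =
    (\int[P]_w Sg t w)%R%:E.
  move=> t1; rewrite unlock /Rintegral fineK; last first.
    by apply: integrable_fin_num => //; apply: bounded_mfun_integrable; exact: bSg.
  apply: eq_integral => w _; rewrite lqnorm_expE// gt_eqF//; lra.
(* If the minimum exceeded [r], so would every expectation, and their sum would exceed [T * r],
   against [sumSg] and [rate_bound]. *)
rewrite leNgt; apply/negP => lt_min.
set r := C * ln T%:R / Num.sqrt T%:R in lt_min.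
have rlt t : (1 <= t <= T)%N -> r < (\int[P]_w Sg t w)%R.
  move=> /andP[t1 tT]; rewrite -lte_fin -expE//; apply: lt_le_trans lt_min _.
  rewrite (big_rem t)/=; last by rewrite mem_index_iota t1.
  by rewrite ge_min lexx.
have A0 : 0 <= A by rewrite !mulr_ge0 ?sqr_ge0// ltW.
have B0 : 0 <= B.
  (* [Delta] is nonnegative because [Lstar] bounds [L theta1] from below. *)
  have := Ls theta1 => h; rewrite addr_ge0//; first by lra.
  by rewrite mulr_ge0 ?(ltW eta_gt0)// divr_ge0// sqrtr_ge0.
have := rate_bound T2 A0 B0 c_gt0 eps_gt0 eta_gt0; rewrite -/C -/r -/kappa.
move=> hrate.
have T0 : (0 < T)%N by exact: leq_trans T2.
have kappa0 : 0 < kappa by rewrite divr_gt0// sqrtr_gt0 ltr_wpDl.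
have : T%:R * r < \sum_(s < T) (\int[P]_w Sg s.+1 w)%R.
  rewrite -[T in T%:R](card_ord T) -sum1_card natr_sum mulr_suml.
  apply: ltr_sum => [|s _]; last by rewrite mul1r rlt//= ltn_ord.
  by apply/hasP; exists (Ordinal T0); rewrite ?mem_index_enum.
move: sumSg; rewrite /K ler_pdivlMr// => h1; rewrite -(ltr_pM2l kappa0).
rewrite -(ltr_pM2l eta_gt0) => h2; move: hrate.
by rewrite -(mulrA eta kappa) => h3; move: h1; rewrite mulrC; lra.
Qed.
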